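(* No second-order linear multistep method exists for which $-\delta(\zeta)$ is a Pick function and is analytic for $\zeta\in(-\infty,1)$. That is, there is no rational function $$\delta(\zeta)=\frac{a_0\zeta^\ell+a_1\zeta^{\ell-1}+\cdots+a_\ell}{b_0\zeta^\ell+b_1\zeta^{\ell-1}+\cdots+b_\ell}$$ with real coefficients $a_j,b_j$ such that $\frac1\tau\delta(e^{-\tau})=1+O(\tau^2)$ as $\tau\to0^+$, $-\delta$ is a Pick function, and $-\delta$ is analytic on $(-\infty,1)$.
   Context: A Pick (Nevanlinna) function is a function $\phi$ that is analytic in the open upper half-plane $\mathbb C^+$ and has non-negative imaginary part there. For a linear multistep method $\sum_{j=0}^\ell a_jy^{n+j-\ell}=\tau\sum_{j=0}^\ell b_j\big(\lambda y^{n+j-\ell}+u(t_{n+j-\ell})\big)$ for $y'=\lambda y+u$ with step size $\tau$, $\delta(\zeta)$ denotes the quotient of generating polynomials displayed in the claim. The method is consistent of order $p$ if and only if $\frac1\tau\delta(e^{-\tau})=1+O(\tau^p)$; ''second-order'' means that this holds with $p=2$. *)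

(* Defs.v *)
From HB Require Import structures.
From mathcomp Require Import all_boot all_order all_algebra.
From mathcomp Require Import all_classical all_reals all_analysis.
From mathcomp Require Export complex.

Set Implicit Arguments.
Unset Strict Implicit.
Unset Printing Implicit Defensive.

Import Order.TTheory GRing.Theory Num.Theory.
Import numFieldNormedType.Exports.

Local Open Scope classical_set_scope.
Local Open Scope ring_scope.
Local Open Scope complex_scope.

(* The standard topology and norm of R[i], as for any numFieldType. *)
HB.instance Definition _ (R : realType) := NormedModule.copy R[i] R[i]^o.

(* [derivable f w 1] over the field R[i] is complex differentiability at w;
   analyticity is complex differentiability on a neighborhood. *)
Definition analytic_at (R : realType) (f : R[i] -> R[i]) (z : R[i]) : Prop :=
  \forall w \near z, derivable f w 1.

Definition analytic_on (R : realType) (f : R[i] -> R[i]) (A : set R[i]) : Prop :=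
  forall z, A z -> analytic_at f z.

Definition upper_half_plane (R : realType) : set R[i] := [set z | 0 < complex.Im z].
Arguments upper_half_plane : clear implicits.

Definition pick_function (R : realType) (f : R[i] -> R[i]) : Prop :=
  analytic_on f (upper_half_plane R) /\
  (forall z, upper_half_plane R z -> 0 <= complex.Im (f z)).

Definition gen_poly (R : realType) (l : nat) (c : 'I_l.+1 -> R) : {poly R} :=
  \sum_(j < l.+1) c j *: 'X^(l - j).

Definition ceval (R : realType) (p : {poly R}) (z : R[i]) : R[i] :=
  (map_poly (real_complex R) p).[z].

(* delta is the rational function with numerator coefficients a and denominator
   coefficients b.  Common zeros of numerator and denominator are allowed, so the
   values of delta at the zeros of the denominator are left free: whenever delta
   is required to be analytic at such a point, the singularity has to be
   removable and delta takes the limit value there. *)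
Definition is_quotient (R : realType) (l : nat) (a b : 'I_l.+1 -> R)
    (delta : R[i] -> R[i]) : Prop :=
  gen_poly b != 0 /\
  forall z, ceval (gen_poly b) z != 0 ->
    delta z = ceval (gen_poly a) z / ceval (gen_poly b) z.

Definition consistent_of_order (R : realType) (p : nat)
    (delta : R[i] -> R[i]) : Prop :=
  (fun t : R => complex.Re `|t^-1%:C * delta (expR (- t))%:C - 1|)
    =O_ (0^'+) (fun t : R => t ^+ p).

(* Main.v *)
Require Import Defs.
From mathcomp Require Import all_boot all_order all_algebra.
From mathcomp Require Import all_classical all_reals all_analysis.
From mathcomp Require Import ring lra zify.
Import Order.TTheory GRing.Theory Num.Theory.
Import numFieldNormedType.Exports.
Local Open Scope classical_set_scope.
Local Open Scope ring_scope.
Local Open Scope complex_scope.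

(** Put f = - delta. After cancelling common factors f is a real quotient P / Q
    whose denominator has no zero where f is analytic: none in the upper
    half-plane, hence by conjugation none in the lower one, and none on
    ]-oo, 1[. So every pole of f is real and at least 1.

    Next to a pole x of order m, f behaves like c (z - x)^-m, and at infinity
    like c z^m when deg P - deg Q = m. If m >= 2, the argument of such a power
    runs through more than a half turn as z crosses the upper half-plane, so
    Im f takes both signs there. Hence the poles are simple, Im f >= 0 makes
    the residues negative ([pick_residue_lt0]), and f grows at most linearly
    ([pick_degree]). Partial fractions then give
      f z = L z + \sum_k |c_k| / (x_k - z),  L affine,  x_k >= 1,
    and each term is convex on ]-oo, 1[ ([pick_quotient_convex]): this is the
    Nevanlinna representation, which for a rational function is pure algebra.

    Second-order consistency contradicts this convexity
    ([second_order_not_concave]): it says that f agrees with ln up to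
    O((1 - z)^3) as z tends to 1 from below, and ln is strictly concave, with
    second derivative -1 at 1. *)

(** * Removable singularities of a quotient of polynomials *)

Lemma continuous_horner_num {K : numFieldType} (p : {poly K}) :
  continuous (horner p).
Proof.
elim/poly_ind: p => [|p c IHp] z.
  have -> : horner (0 : {poly K}) = cst 0 by apply/funext => w; rewrite horner0.
  exact: cst_continuous.
have -> : horner (p * 'X + c%:P) = (fun w => p.[w] * w + c).
  by apply/funext => w; rewrite hornerMXaddC.
have IHM : {for z, continuous (fun w => p.[w] * w)}.
  by apply: (continuousM (IHp z)); exact: cvg_id.
apply: (continuousD IHM); exact: cst_continuous.
Qed.

Lemma near_not_root {K : numFieldType} (b : {poly K}) (z : K) : b != 0 ->
  \forall w \near z^', b.[w] != 0.
Proof.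
move=> b0; have [m [c /implyP/(_ b0) cz ->]] := multiplicity_XsubC b z.
have ncz : \forall w \near z^', c.[w] != 0.
  apply: (@nbhs_dnbhs K z).
  have /cvg_ball/(_ `|c.[z]|) := @continuous_horner_num K c z.
  rewrite normr_gt0 => /(_ cz); apply: filterS => w.
  by rewrite /ball/= => cw; apply: contraTneq cw => ->; rewrite subr0 ltxx.
near=> w.
rewrite hornerM mulf_neq0 //; first by near: w.
rewrite horner_exp expf_neq0 // hornerXsubC subr_eq0.
by near: w; exact: nbhs_dnbhs_neq.
Unshelve. all: by end_near. Qed.

(** Both sides are continuous at z and agree on a punctured neighborhood, since
    b has isolated zeros. *)
Lemma eq_at_removable {K : numFieldType} (b p q : {poly K}) (f : K -> K) (z : K) :
  b != 0 -> (forall w, b.[w] != 0 -> f w * q.[w] = p.[w]) ->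
  {for z, continuous f} -> f z * q.[z] = p.[z].
Proof.
move=> b0 fqp fz.
have cfq : f w * q.[w] @[w --> z^'] --> f z * q.[z].
  apply: cvg_within_filter.
  by apply: cvgM; [exact: fz|exact: continuous_horner_num].
have cp : f w * q.[w] @[w --> z^'] --> p.[z].
  have : p.[w] @[w --> z^'] --> p.[z].
    by apply: cvg_within_filter; exact: continuous_horner_num.
  apply: cvg_trans; apply: near_eq_cvg.
  by apply: filterS (near_not_root b z b0) => w /fqp ->.
exact: (cvg_unique _ cfq cp).
Qed.

Lemma derivable_complex_continuous {R : realType} (f : R[i] -> R[i]) (z : R[i]) :
  derivable f z 1 -> {for z, continuous f}.
Proof. by move=> /(derivable1_diffP f z) /differentiable_continuous. Qed.

Lemma ceval_conj {R : realType} (p : {poly R}) (z : R[i]) :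
  conjc (ceval p z) = ceval p (conjc z).
Proof.
rewrite /ceval -horner_map -map_poly_comp /=; congr (_.[_]).
by apply: eq_map_poly => x /=; rewrite oppr0.
Qed.

Lemma ceval_real {R : realType} (p : {poly R}) (x : R) :
  ceval p x%:C = (p.[x])%:C.
Proof. exact: horner_map. Qed.

Lemma coprime_no_common_root {R : realType} (P Q : {poly R}) (z : R[i]) :
  coprimep P Q -> ceval Q z = 0 -> ceval P z != 0.
Proof.
rewrite -(coprimep_map (real_complex R)) coprimep_sym => cPQ /eqP Qz.
exact: coprimep_root cPQ Qz.
Qed.

(** Written without division, the identity survives at the zeros of Q; with
    coprimality it then shows that Q has no zero where f is differentiable. *)
Lemma quotient_normal_form {R : realType} (A B : {poly R}) (f : R[i] -> R[i]) :
  B != 0 -> (forall z, ceval B z != 0 -> f z = ceval A z / ceval B z) ->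
  exists P Q : {poly R}, [/\ Q != 0, coprimep P Q &
    forall z, derivable f z 1 -> f z * ceval Q z = ceval P z].
Proof.
move=> B0 fAB; pose G := gcdp A B.
have EA : A = (A %/ G) * G by rewrite divpK// dvdp_gcdl.
have EB : B = (B %/ G) * G by rewrite divpK// dvdp_gcdr.
have EAw w : ceval A w = ceval (A %/ G) w * ceval G w.
  by rewrite {1}EA /ceval rmorphM hornerM.
have EBw w : ceval B w = ceval (B %/ G) w * ceval G w.
  by rewrite {1}EB /ceval rmorphM hornerM.
exists (A %/ G), (B %/ G); split.
- by apply: contraNneq B0 => Q0; rewrite EB Q0 mul0r.
- by rewrite coprimep_div_gcd// B0 orbT.
move=> z /derivable_complex_continuous fz.
have BC0 : map_poly (real_complex R) B != 0 by rewrite map_poly_eq0.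
apply: (eq_at_removable _ _ _ f z BC0 _ fz) => w Bw.
rewrite -/(ceval (B %/ G) w) -/(ceval (A %/ G) w) (fAB w Bw).
move: Bw; rewrite -/(ceval B w) EAw EBw mulf_eq0 negb_or => /andP[Qw Gw].
by rewrite -mulf_div divff// mulr1 divfK.
Qed.

(** * Partial fractions with simple real poles *)

Lemma uniq_simple_roots {F : fieldType} (xs : seq F) :
  (forall x, x \in xs -> (\prod_(y <- xs) ('X - y%:P))^`().[x] != 0) -> uniq xs.
Proof.
elim: xs => //= x xs IH H.
set T := \prod_(y <- xs) ('X - y%:P).
have E y : (\prod_(z <- x :: xs) ('X - z%:P))^`().[y] = T.[y] + (y - x) * T^`().[y].
  by rewrite big_cons derivM derivXsubC !hornerE.
have xT : x \notin xs.
  have := H x (mem_head _ _).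
  by rewrite E subrr mul0r addr0 -/(root T x) root_prod_XsubC.
rewrite xT /=; apply: IH => y yxs.
have := H y; rewrite inE yxs orbT => /(_ isT); rewrite E.
have /eqP -> : T.[y] == 0 by rewrite -/(root T y) root_prod_XsubC.
by rewrite add0r; apply: contraNneq => ->; rewrite mulr0.
Qed.

Lemma real_roots_split {R : realType} (Q : {poly R}) : Q != 0 ->
  (forall r : R[i], ceval Q r = 0 -> exists x : R, r = x%:C) ->
  exists xs : seq R, Q = lead_coef Q *: \prod_(x <- xs) ('X - x%:P).
Proof.
move=> Q0 rQ.
have [zs E] := closed_field_poly_normal (map_poly (real_complex R) Q).
exists (map (@complex.Re R) zs).
apply: (map_poly_inj (real_complex R)); rewrite {1}E lead_coef_map map_polyZ /=.
congr (_ *: _); rewrite rmorph_prod big_map !big_seq; apply: eq_bigr => z zzs.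
have [x ->] : exists x : R, z = x%:C.
  apply: rQ; apply/eqP; rewrite -/(root _ z) E rootZ ?root_prod_XsubC//.
  by rewrite lead_coef_eq0 map_poly_eq0.
by rewrite rmorphB /= map_polyX map_polyC.
Qed.

(** Lagrange interpolation: the Q / (X - x), normalized at x by the value Q'(x)
    that Q / (X - x) takes there, interpolate P at the roots of Q, so that Q
    divides the remainder. The bound on the size of P makes the quotient L
    affine. *)
Lemma partial_fractions {F : fieldType} (P Q : {poly F}) (xs : seq F) :
  uniq xs -> Q %= \prod_(x <- xs) ('X - x%:P) ->
  (forall x, x \in xs -> Q^`().[x] != 0) -> (size P <= (size Q).+1)%N ->
  exists2 L : {poly F}, (size L <= 2)%N &
  forall z, Q.[z] != 0 ->
    P.[z] / Q.[z] = L.[z] + \sum_(x <- xs) P.[x] / Q^`().[x] / (z - x).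
Proof.
move=> uxs Qxs Q'0 sPQ.
have Q0 : Q != 0.
  by rewrite -size_poly_eq0 (eqp_size Qxs) size_prod_XsubC.
pose D x := Q %/ ('X - x%:P).
have rQ x : root Q x = (x \in xs).
  by rewrite (eqp_root Qxs) root_prod_XsubC.
have DQ x : x \in xs -> D x * ('X - x%:P) = Q.
  by move=> xxs; rewrite divpK// dvdp_XsubCl rQ.
have Dx x : x \in xs -> (D x).[x] = Q^`().[x].
  move=> xxs; rewrite -(DQ _ xxs) derivM derivXsubC.
  by rewrite !hornerE subrr mulr0 add0r.
have Dy x y : x \in xs -> y \in xs -> y != x -> (D x).[y] = 0.
  move=> xxs yxs yx; have : Q.[y] = 0 by apply/eqP; rewrite -/(root Q y) rQ.
  rewrite -{1}(DQ _ xxs) hornerM hornerXsubC => /eqP.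
  by rewrite mulf_eq0 subr_eq0 (negPf yx) orbF => /eqP.
pose c x := P.[x] / Q^`().[x].
pose S := \sum_(x <- xs) c x *: D x.
have Sy y : y \in xs -> S.[y] = P.[y].
  move=> yxs; rewrite horner_sum (bigD1_seq y)//= big_seq_cond big1 ?addr0.
    by rewrite hornerZ Dx// divfK// Q'0.
  by move=> x /andP[xxs xy]; rewrite hornerZ Dy ?mulr0// eq_sym.
have QN : Q %| P - S.
  rewrite (eqp_dvdl _ Qxs) uniq_roots_dvdp//; last by rewrite uniq_rootsE.
  by apply/allP => y yxs; rewrite rootE !hornerE Sy// subrr.
have sS : (size S <= size Q)%N.
  apply: (leq_trans (size_sum _ _ _)); apply/bigmax_leqP_seq => x xxs _.
  by rewrite (leq_trans (size_scale_leq _ _))// leq_divp.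
exists ((P - S) %/ Q).
  rewrite size_divp// leq_subLR.
  apply: (leq_trans (size_polyD _ _)); rewrite size_polyN geq_max.
  have : (0 < size Q)%N by rewrite size_poly_gt0.
  case: (size Q) sPQ sS => //= n sP sS _; rewrite addn2.
  by rewrite sP (leq_trans sS).
move=> z Qz; apply: (mulIf Qz); rewrite divfK// mulrDl -hornerM divpK//.
rewrite hornerD hornerN -[LHS](subrK S.[z]); congr (_ + _).
rewrite horner_sum mulr_suml !big_seq; apply: eq_bigr => x xxs.
rewrite hornerZ -{2}(DQ _ xxs) hornerM hornerXsubC /c.
have zx : z - x != 0.
  by rewrite subr_eq0; apply: contraNneq Qz => ->; rewrite -/(root Q x) rQ.
by rewrite -[RHS]mulrA [_^-1 * _]mulrCA mulVf ?mulr1.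
Qed.

(** * Behaviour of a rational Pick function at its poles and at infinity *)

Lemma de_moivre {R : realType} (t : R) (m : nat) :
  (cos t +i* sin t) ^+ m = cos (t *+ m) +i* sin (t *+ m).
Proof.
elim: m => [|m IHm]; first by rewrite !mulr0n cos0 sin0.
rewrite exprS IHm mulrS cosD sinD.
by apply/eqP; rewrite eq_complex /=; apply/andP; split; apply/eqP; ring.
Qed.

(** For m >= 2 the rays of arguments pi / (2 m) and 3 pi / (2 m) both lie in the
    open upper half-plane, and u ^+ m equals i on the first, - i on the second
    (for u of modulus 1). *)
Lemma power_semidefinite_le1 {R : realType} (c : R) (m : nat) : c != 0 ->
  (forall u : R[i], 0 < complex.Im u -> 0 <= c * complex.Im (u ^+ m)) ->
  (m <= 1)%N.
Proof.
move=> c0 H; rewrite leqNgt; apply/negP => m2.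
have m0 : 0 < m%:R :> R by rewrite ltr0n ltnW.
have pi0 := pi_gt0 R.
have m2R : 2 <= m%:R :> R by rewrite ler_nat.
have E (a : R) : 0 < a < 2 -> 0 <= c * sin (a * pi).
  move=> /andP[a0 a2]; pose t : R := a * pi / m%:R.
  have tm : t *+ m = a * pi by rewrite -mulr_natr divfK// gt_eqF.
  have /H : 0 < complex.Im (cos t +i* sin t).
    rewrite /= sin_gt0_pi// divr_gt0 ?mulr_gt0//= ltr_pdivrMr// mulrC ltr_pM2l//.
    exact: lt_le_trans m2R.
  by rewrite de_moivre /= tm.
have h1 : 0 <= c.
  have := E (2^-1) ltac:(lra); rewrite mulrC [2^-1 * _]mulrC.
  by rewrite sin_pihalf mul1r.
have h2 : c <= 0.
  have := E (1 + 2^-1) ltac:(lra).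
  have -> : (1 + 2^-1) * pi = pi / 2 + pi :> R by field.
  by rewrite sinDpi sin_pihalf; lra.
by move/eqP: c0; apply; lra.
Qed.

Lemma horner_real_split {R : realType} (F : {poly R[i]}) :
  exists G H : {poly R}, forall s : R, F.[s%:C] = G.[s] +i* H.[s].
Proof.
elim/poly_ind: F => [|F [a b] [G [H E]]].
  by exists 0, 0 => s; rewrite !horner0.
exists (G * 'X + a%:P), (H * 'X + b%:P) => s.
rewrite !hornerMXaddC E; apply/eqP; rewrite eq_complex /=.
by apply/andP; split; apply/eqP; ring.
Qed.

(** The limit argument shared by the analyses at a pole and at infinity: along a
    ray, both reduce to a polynomial in a real parameter s > 0 whose value at 0
    is the leading term. *)
Lemma Im_horner_ge0 {R : realType} (F : {poly R[i]}) :
  (forall s : R, 0 < s -> 0 <= complex.Im F.[s%:C]) -> 0 <= complex.Im F.[0].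
Proof.
have [G [H E]] := horner_real_split F => F0.
have -> : complex.Im F.[0] = H.[0] by rewrite (E 0).
have HH : H.[s] @[s --> 0^'+] --> H.[0].
  by apply: cvg_at_right_filter; exact: continuous_horner.
apply: (cvgr_to_ge HH); near=> s.
by have := F0 s; rewrite E /=; apply; near: s; exact: nbhs_right_gt.
Unshelve. all: by end_near. Qed.

(** P / Q has non-negative imaginary part on the upper half-plane: multiplying
    by |Q|^2 keeps the sign and makes the condition polynomial. *)
Definition pick_quotient {R : realType} (P Q : {poly R}) : Prop :=
  forall z : R[i], 0 < complex.Im z ->
    0 <= complex.Im (ceval P z * conjc (ceval Q z)).

Lemma Im_realM {R : realType} (c : R) (w : R[i]) :
  complex.Im (c%:C * w) = c * complex.Im w.
Proof. by case: w => a b /=; rewrite mul0r addr0. Qed.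

(** On the ray z = x + s u, the polynomial P(z) conj(Q(z)) is s^m times one whose
    value at s = 0 is P(x) Q1(x) conj(u)^m. Conjugation turns into the minus
    sign. *)
Lemma pick_leading_term_at_root {R : realType} (P Q1 : {poly R}) (m : nat) (x : R) :
  pick_quotient P (Q1 * ('X - x%:P) ^+ m) ->
  forall u : R[i], 0 < complex.Im u ->
    0 <= - (P.[x] * Q1.[x]) * complex.Im (u ^+ m).
Proof.
move=> PQ u u0.
pose lc (p : {poly R}) (v : R[i]) :=
  map_poly (real_complex R) p \Po (v *: 'X + x%:C%:P).
have lcE p v (s : R) : (lc p v).[s%:C] = ceval p (x%:C + s%:C * v).
  by rewrite horner_comp !hornerE /ceval [v * _]mulrC addrC.
have := @Im_horner_ge0 R (lc P u * lc Q1 (conjc u) * (conjc u ^+ m)%:P).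
have -> : (lc P u * lc Q1 (conjc u) * (conjc u ^+ m)%:P).[0]
    = (P.[x] * Q1.[x])%:C * conjc (u ^+ m).
  rewrite !hornerM hornerC -[0]/(0%:C) !lcE !mul0r addr0 !ceval_real.
  by rewrite rmorphM rmorphXn.
rewrite Im_realM => H.
suff: 0 <= P.[x] * Q1.[x] * complex.Im (conjc (u ^+ m)).
  by case: (u ^+ m) => a b /=; rewrite mulrN mulNr.
apply: H => s s0.
have /PQ : 0 < complex.Im (x%:C + s%:C * u).
  by case: u u0 => a b /= b0; rewrite mul0r addr0 add0r mulr_gt0.
rewrite ceval_conj !hornerM hornerC !lcE.
have -> : conjc (x%:C + s%:C * u) = x%:C + s%:C * conjc u.
  by rewrite rmorphD rmorphM /= !oppr0.
have -> : ceval (Q1 * ('X - x%:P) ^+ m) (x%:C + s%:C * conjc u)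
    = (s ^+ m)%:C * (ceval Q1 (x%:C + s%:C * conjc u) * conjc u ^+ m).
  rewrite /ceval rmorphM rmorphXn rmorphB /= map_polyX map_polyC /=.
  rewrite hornerM horner_exp hornerXsubC addrAC subrr add0r exprMn rmorphXn /=.
  by rewrite mulrCA.
rewrite mulrCA Im_realM pmulr_rge0 ?exprn_gt0//.
by rewrite mulrA.
Qed.

(** The residue of P / Q at x is P(x) / Q'(x), which has the sign of the product
    here; that the product is nonzero says that the root is simple. *)
Lemma pick_residue_lt0 {R : realType} (P Q : {poly R}) (x : R) :
  Q != 0 -> coprimep P Q -> pick_quotient P Q -> root Q x ->
  P.[x] * Q^`().[x] < 0.
Proof.
move=> Q0 cPQ PQ Qx.
have [m [Q1 /implyP/(_ Q0) Q1x defQ]] := multiplicity_XsubC Q x.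
rewrite defQ in PQ.
have Px : P.[x] != 0 by apply: coprimep_root Qx; rewrite coprimep_sym.
have c0 : - (P.[x] * Q1.[x]) != 0 by rewrite oppr_eq0 mulf_neq0.
have loc := pick_leading_term_at_root _ _ _ _ PQ.
have m1 := power_semidefinite_le1 _ _ c0 loc.
case: m m1 defQ PQ loc => [|[]]// _ defQ _ loc.
  by move: Qx; rewrite defQ expr0 mulr1 (negPf Q1x).
have -> : Q^`().[x] = Q1.[x].
  by rewrite defQ expr1 derivM derivXsubC !hornerE subrr mulr0 add0r.
have := loc 'i ltr01; rewrite expr1 /= mulr1 oppr_ge0 => le0.
by rewrite lt_neqAle le0 -oppr_eq0 c0.
Qed.

(** The reversed polynomial of p, with u absorbed in its coefficients: it turns
    the behaviour at infinity along the ray u / s into a value at s = 0. *)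
Lemma reversed_poly_at_infty {R : realType} (p : {poly R}) (u : R[i]) :
  exists2 G : {poly R[i]}, G.[0] = (lead_coef p)%:C * u ^+ (size p).-1 &
  forall s : R, s != 0 -> G.[s%:C] = (s ^+ (size p).-1)%:C * ceval p (u / s%:C).
Proof.
pose n := (size p).-1.
exists (\poly_(j < n.+1) ((p`_(n - j))%:C * u ^+ (n - j))).
  by rewrite horner_coef0 coef_poly subn0.
move=> s s0; rewrite horner_poly.
have sz : (size (map_poly (real_complex R) p) <= n.+1)%N.
  by rewrite size_map_poly leqSpred.
rewrite /ceval (horner_coef_wide _ sz) mulr_sumr.
rewrite (reindex_inj rev_ord_inj) /=; apply: eq_bigr => -[i /= ilt] _.
rewrite ltnS in ilt.
rewrite subSS subKn// coef_map /= expr_div_n rmorphXn /=.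
have s0C : s%:C != 0 :> R[i] by rewrite eq_complex /= eqxx andbT.
have -> : s%:C ^+ (size p).-1 = s%:C ^+ (n - i) * s%:C ^+ i :> R[i].
  by rewrite -exprD subnK.
by field; rewrite expf_neq0.
Qed.

(** At infinity P conj(Q) has leading term lc(P) lc(Q) |u|^(2 deg Q) u^m along the
    ray of direction u, with m = deg P - deg Q, so m <= 1. *)
Lemma pick_degree {R : realType} (P Q : {poly R}) :
  Q != 0 -> pick_quotient P Q -> (size P <= (size Q).+1)%N.
Proof.
move=> Q0 PQ; rewrite leqNgt; apply/negP => lt.
have P0 : P != 0 by rewrite -size_poly_gt0 (leq_ltn_trans _ lt).
have sQ : (0 < size Q)%N by rewrite size_poly_gt0.
pose m := ((size P).-1 - (size Q).-1)%N.
have c0 : lead_coef P * lead_coef Q != 0 by rewrite mulf_neq0 ?lead_coef_eq0.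
suff /(power_semidefinite_le1 _ _ c0) : forall u : R[i], 0 < complex.Im u ->
    0 <= lead_coef P * lead_coef Q * complex.Im (u ^+ m).
  by rewrite /m; lia.
move=> u u0.
have [GP GP0 GPE] := reversed_poly_at_infty P u.
have [GQ GQ0 GQE] := reversed_poly_at_infty Q (conjc u).
have := @Im_horner_ge0 R (GP * GQ).
rewrite hornerM GP0 GQ0.
have -> : (lead_coef P)%:C * u ^+ (size P).-1
      * ((lead_coef Q)%:C * conjc u ^+ (size Q).-1)
    = ((complex.Re u ^+ 2 + complex.Im u ^+ 2) ^+ (size Q).-1 *
       (lead_coef P * lead_coef Q))%:C * u ^+ m.
  have -> : (size P).-1 = ((size Q).-1 + m)%N by rewrite /m; lia.
  rewrite 2!rmorphM rmorphXn /=.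
  have -> : (complex.Re u ^+ 2 + complex.Im u ^+ 2)%:C = u * conjc u.
    case: u {u0 GPE GP0 GQE GQ0} => a b; apply/eqP; rewrite eq_complex /=.
    by apply/andP; split; apply/eqP; ring.
  by rewrite exprD exprMn; ring.
rewrite Im_realM -mulrA pmulr_rge0; last first.
  by rewrite exprn_gt0// ltr_wpDl ?sqr_ge0// exprn_gt0.
apply => s s0.
have /PQ : 0 < complex.Im (u / s%:C).
  by rewrite mulrC -fmorphV Im_realM mulr_gt0 ?invr_gt0.
rewrite hornerM GPE ?gt_eqF// GQE ?gt_eqF// ceval_conj.
have -> : conjc (u / s%:C) = conjc u / s%:C.
  by rewrite fmorph_div /= oppr0.
rewrite mulrACA -rmorphM Im_realM => H.
by rewrite mulr_ge0// mulr_ge0// exprn_ge0// ltW.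
Qed.

(** * Convexity of a rational Pick function to the left of its poles *)

Lemma inv_convex {R : realFieldType} (A B s : R) : 0 < A -> 0 < B ->
  0 <= s <= 1 -> (s * A + (1 - s) * B)^-1 <= s / A + (1 - s) / B.
Proof.
move=> A0 B0 /andP[s0 s1].
have D0 : 0 < s * A + (1 - s) * B.
  have [->|sn0] := eqVneq s 0; first by rewrite mul0r subr0 mul1r add0r.
  have sp : 0 < s by rewrite lt_def sn0.
  by rewrite ltr_wpDr ?mulr_gt0 // mulr_ge0 ?subr_ge0 // ltW.
have -> : s / A + (1 - s) / B
    = (s * A + (1 - s) * B)^-1
      + s * (1 - s) * (A - B) ^+ 2 * ((s * A + (1 - s) * B) * (A * B))^-1.
  by field; rewrite !gt_eqF.
rewrite lerDl mulr_ge0 ?invr_ge0 //; last by rewrite ltW ?mulr_gt0.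
by rewrite mulr_ge0 ?sqr_ge0// mulr_ge0 ?subr_ge0.
Qed.

Lemma poly_affine {F : comNzRingType} (L : {poly F}) (u v s : F) : (size L <= 2)%N ->
  L.[s * u + (1 - s) * v] = s * L.[u] + (1 - s) * L.[v].
Proof.
move=> sL; rewrite !(horner_coef_wide _ sL) !big_ord_recl !big_ord0 /=.
by rewrite /bump /=; ring.
Qed.

Lemma poles_convex {R : realFieldType} (L : {poly R}) (c : R -> R) (xs : seq R)
    (u v s b : R) :
  (size L <= 2)%N -> (forall x, x \in xs -> b <= x /\ c x <= 0) ->
  u < b -> v < b -> 0 <= s <= 1 ->
  let f z := L.[z] + \sum_(x <- xs) c x / (z - x) in
  f (s * u + (1 - s) * v) <= s * f u + (1 - s) * f v.
Proof.
move=> sL cx ub vb s01 /=; rewrite poly_affine// !mulrDr.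
rewrite addrACA lerD2l !mulr_sumr -big_split /= !big_seq.
apply: ler_sum => x /cx[bx c0].
have ux : 0 < x - u by rewrite subr_gt0 (lt_le_trans ub).
have vx : 0 < x - v by rewrite subr_gt0 (lt_le_trans vb).
have {}c0 : 0 <= - c x by rewrite oppr_ge0.
have NV y z : y / (z - x) = - y * (x - z)^-1 by rewrite -opprB invrN mulrN mulNr.
rewrite !NV [leRHS](_ : _ = - c x * (s / (x - u) + (1 - s) / (x - v)));
  last by ring.
apply: ler_wpM2l => //.
have -> : x - (s * u + (1 - s) * v) = s * (x - u) + (1 - s) * (x - v) by ring.
exact: inv_convex.
Qed.

Lemma pick_quotient_convex {R : realType} (P Q : {poly R}) (b u v s : R) :
  Q != 0 -> coprimep P Q -> pick_quotient P Q ->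
  (forall r : R[i], ceval Q r = 0 -> exists2 x : R, r = x%:C & b <= x) ->
  u < b -> v < b -> 0 <= s <= 1 ->
  let f z := P.[z] / Q.[z] in
  f (s * u + (1 - s) * v) <= s * f u + (1 - s) * f v.
Proof.
move=> Q0 cPQ PQ rQ ub vb s01.
have [|xs Qxs] := real_roots_split Q Q0.
  by move=> r /rQ[x -> _]; exists x.
have rxs x : root Q x = (x \in xs).
  by rewrite Qxs rootZ ?lead_coef_eq0// root_prod_XsubC.
have bxs x : root Q x -> b <= x.
  by move=> /eqP Qx; have [|y [->]//] := rQ x%:C; rewrite ceval_real Qx.
have res x : x \in xs -> P.[x] * Q^`().[x] < 0.
  by rewrite -rxs; exact: pick_residue_lt0.
have Q'0 x : x \in xs -> Q^`().[x] != 0.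
  by move=> /res; apply: contraTneq => ->; rewrite mulr0 ltxx.
have uxs : uniq xs.
  apply: uniq_simple_roots => x /Q'0; rewrite {1}Qxs derivZ hornerZ.
  by apply: contraNneq => ->; rewrite mulr0.
have Qeq : Q %= \prod_(x <- xs) ('X - x%:P).
  by rewrite {1}Qxs eqp_scale ?lead_coef_eq0.
have [L sL fE] := partial_fractions P Q xs uxs Qeq Q'0 (pick_degree P Q Q0 PQ).
have Qn0 z : z < b -> Q.[z] != 0.
  by move=> zb; apply/negP => /bxs; rewrite leNgt zb.
have wb : s * u + (1 - s) * v < b.
  move: s01 => /andP[s0 s1].
  have [->|sn0] := eqVneq s 0; first by rewrite mul0r add0r subr0 mul1r.
  have sp : 0 < s by rewrite lt_def sn0.
  nra.
rewrite /= !fE ?Qn0//.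
apply: (@poles_convex R L (fun x => P.[x] / Q^`().[x]) xs u v s b) => // x xxs.
split; first by rewrite bxs ?rxs.
have -> : P.[x] / Q^`().[x] = P.[x] * Q^`().[x] * (Q^`().[x] ^- 2).
  by field; exact: Q'0.
by rewrite mulr_le0_ge0 ?ltW ?res// invr_gt0 exprn_even_gt0//= Q'0.
Qed.

(** * Second-order consistency against concavity *)

(** Write x = exp(- t). Concavity at x^2, between x and x^3, reads
      (1 + x) d(x^2) >= x d(x) + d(x^3).
    With d(exp(- t)) = t + O(t^3) this becomes x t >= t - O(t^3), that is
    exp(- t) >= 1 - O(t^2), which contradicts exp(- t) <= 1 / (1 + t). Using
    the points x, x^2, x^3 avoids evaluating d at 1 and expanding the
    logarithm. *)
Lemma second_order_not_concave {R : realType} (d : R -> R) (C e : R) : 0 < e ->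
  (forall t, 0 < t -> t < e -> `|t^-1 * d (expR (- t)) - 1| <= C * t ^+ 2) ->
  ~ (forall u v s, u < 1 -> v < 1 -> 0 <= s <= 1 ->
       s * d u + (1 - s) * d v <= d (s * u + (1 - s) * v)).
Proof.
move=> e0 cons conc.
have bd t : 0 < t -> t < e -> t - C * t ^+ 3 <= d (expR (- t)) <= t + C * t ^+ 3.
  move=> t0 te; have := cons t t0 te; rewrite ler_distl => /andP[h1 h2].
  have E : d (expR (- t)) = t * (t^-1 * d (expR (- t))).
    by rewrite mulrA mulfV ?mul1r// gt_eqF.
  have E3 : C * t ^+ 3 = t * (C * t ^+ 2) by ring.
  rewrite E E3; apply/andP; split.
    by rewrite -[X in X - _]mulr1 -mulrBr ler_pM2l.
  by rewrite -[X in X + _]mulr1 -mulrDr ler_pM2l.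
have C0 : 0 <= C.
  have e2 : 0 < e / 2 by lra.
  have := le_trans (normr_ge0 _) (cons _ e2 ltac:(lra)).
  by rewrite pmulr_lge0// exprn_gt0.
(* The errors C t^3, C (2 t)^3 and C (3 t)^3 at x, x^2 and x^3 enter with
   weights at most 1, 2 and 1: 1 + 2 * 8 + 27 = 44. *)
have key t : 0 < t -> 3 * t < e -> 1 - 44 * C * t ^+ 2 <= expR (- t).
  move=> t0 te; set x := expR (- t).
  have x0 : 0 < x := expR_gt0 _.
  have x1 : x < 1 by rewrite -expR0 ltr_expR oppr_lt0.
  have Ex n : expR (- (n%:R * t)) = x ^+ n by rewrite -mulrN expRM_natl.
  have /andP[d1 _] := bd t t0 ltac:(lra).
  have /andP[_ d2] := bd (2 * t) ltac:(lra) ltac:(lra).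
  have /andP[d3 _] := bd (3 * t) ltac:(lra) ltac:(lra).
  rewrite -/x in d1; rewrite (Ex 2%N) in d2; rewrite (Ex 3%N) in d3.
  have s01 : 0 <= x / (1 + x) <= 1.
    apply/andP; split; first by rewrite divr_ge0//; lra.
    by rewrite ler_pdivrMr; lra.
  have x31 : x ^+ 3 < 1 by rewrite exprn_ilt1 ?ltW.
  (* x / (1 + x) is the barycentric weight for which x and x^3 average to x^2. *)
  have := conc x (x ^+ 3) (x / (1 + x)) x1 x31 s01.
  have -> : x / (1 + x) * x + (1 - x / (1 + x)) * x ^+ 3 = x ^+ 2.
    by field; rewrite gt_eqF//; lra.
  have -> : x / (1 + x) * d x + (1 - x / (1 + x)) * d (x ^+ 3)
      = (x * d x + d (x ^+ 3)) / (1 + x).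
    by field; rewrite gt_eqF//; lra.
  rewrite ler_pdivrMr; last by lra.
  move=> conc3.
  have D1 : x * (t - C * t ^+ 3) <= x * d x by rewrite ler_pM2l.
  have D2 : d (x ^+ 2) * (1 + x) <= (2 * t + C * (2 * t) ^+ 3) * (1 + x).
    by rewrite ler_pM2r//; lra.
  have xC : x * (C * t ^+ 3) <= C * t ^+ 3.
    by rewrite ler_piMl ?(ltW x1)// mulr_ge0// exprn_ge0// ltW.
  rewrite -(ler_pM2l t0).
  have -> : t * (1 - 44 * C * t ^+ 2) = t - 44 * (C * t ^+ 3) by ring.
  have F2 : (2 * t + C * (2 * t) ^+ 3) * (1 + x)
      = 2 * t + 2 * (t * x) + 8 * (C * t ^+ 3) + 8 * (x * (C * t ^+ 3)) by ring.
  have F3 : C * (3 * t) ^+ 3 = 27 * (C * t ^+ 3) by ring.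
  rewrite F2 in D2; rewrite F3 in d3; rewrite mulrBr [x * t]mulrC in D1.
  lra.
(* t = 1 / k is small enough for the consistency bound at 3 t and for
   44 C t (1 + t) < 1. *)
pose k := 1 + 100 * C + 4 / e.
have e4 : 0 < 4 / e by rewrite divr_gt0.
have k1 : 1 <= k by rewrite /k; lra.
have k0 : 0 < k by apply: lt_le_trans k1.
pose t := k^-1.
have t0 : 0 < t by rewrite invr_gt0.
have kt : k * t = 1 by rewrite mulfV// gt_eqF.
have t1 : t <= 1 by rewrite invf_le1//.
have te : 3 * t < e.
  have : 4 / e * t <= 1.
    by rewrite -[leRHS]kt ler_pM2r// /k lerDr; lra.
  by rewrite mulrAC ler_pdivrMr// mul1r; lra.
have ct : 100 * (C * t) <= 1.
  by rewrite mulrA -[leRHS]kt ler_pM2r// /k addrAC lerDr; lra.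
have keyt := key t t0 te.
have xt : expR (- t) * (1 + t) <= 1.
  by rewrite -[leRHS]expR0 -(addNr t) expRD ler_pM2l ?expR_gt0// expR_ge1Dx.
have : (1 - 44 * C * t ^+ 2) * (1 + t) <= 1.
  by apply: le_trans xt; rewrite ler_pM2r//; lra.
have -> : (1 - 44 * C * t ^+ 2) * (1 + t)
    = 1 + t * (1 - 44 * (C * t) - 44 * (C * t) * t) by ring.
rewrite gerDl pmulr_rle0//.
have : C * t * t <= C * t by rewrite ler_piMr// mulr_ge0// ltW.
lra.
Qed.

Theorem lemma4p2 (R : realType) :
  ~ exists (l : nat) (a b : 'I_l.+1 -> R) (delta : R[i] -> R[i]),
      [/\ is_quotient a b delta,
          consistent_of_order 2 delta,
          pick_function (fun z => - delta z) &
          analytic_on (fun z => - delta z) [set x%:C | x in `]-oo, 1[ ]].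
Proof.
move=> [l [a [b [delta [[B0 dAB] cons [pick_an pick_Im] an]]]]].
pose f z := - delta z.
have [|P [Q [Q0 cPQ fPQ]]] :=
  quotient_normal_form (- gen_poly a) (gen_poly b) f B0.
  by move=> z Bz; rewrite /f dAB// /ceval rmorphN hornerN mulNr.
have f_upper z : 0 < complex.Im z -> f z * ceval Q z = ceval P z.
  by move=> z0; apply: fPQ; apply: nbhs_singleton (pick_an z z0).
have f_real (x : R) : x < 1 -> f x%:C * ceval Q x%:C = ceval P x%:C.
  move=> x1; apply: fPQ; apply: nbhs_singleton (an _ _).
  by exists x => //=; rewrite in_itv.
have PQ : pick_quotient P Q.
  move=> z z0; have := pick_Im z z0; rewrite -f_upper// -/(f z).
  case: (f z) (ceval Q z) => [f1 f2] [q1 q2] /= f0.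
  have -> : (f1 * q1 - f2 * q2) * - q2 + (f1 * q2 + f2 * q1) * q1
    = f2 * (q1 ^+ 2 + q2 ^+ 2) by ring.
  by rewrite mulr_ge0// addr_ge0 ?sqr_ge0.
have no_root z : f z * ceval Q z = ceval P z -> ceval Q z != 0.
  move=> E; apply/eqP => Qz; have := coprime_no_common_root P Q z cPQ Qz.
  by rewrite -E Qz mulr0 eqxx.
have rQ r : ceval Q r = 0 -> exists2 x : R, r = x%:C & 1 <= x.
  move=> Qr; have Im0 : complex.Im r = 0.
    have [lt0|gt0|//] := ltgtP (complex.Im r) 0; last first.
      by have := no_root r (f_upper r gt0); rewrite Qr eqxx.
    have r'0 : 0 < complex.Im (conjc r).
      by case: (r) lt0 => x y /=; rewrite oppr_gt0.
    have := no_root _ (f_upper _ r'0).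
    by rewrite -ceval_conj Qr /= oppr0 eqxx.
  case: r Qr Im0 => x y /= Qr y0; rewrite y0 in Qr *; exists x => //.
  rewrite leNgt; apply/negP => x1.
  by have := no_root _ (f_real x x1); rewrite Qr eqxx.
have fE (x : R) : x < 1 -> delta x%:C = (- (P.[x] / Q.[x]))%:C.
  move=> x1; apply: oppr_inj; rewrite -/(f x%:C).
  apply: (mulIf (no_root _ (f_real x x1))); rewrite f_real// !ceval_real.
  rewrite rmorphN opprK -rmorphM divfK//.
  by have := no_root _ (f_real x x1); rewrite ceval_real; apply: contraNneq => ->.
have /eqO_exP [C _ [e /= e0 He]] := cons.
apply: (second_order_not_concave (fun x => - (P.[x] / Q.[x])) C e e0).
  move=> t t0 te.
  have xlt1 : expR (- t) < 1 by rewrite -expR0 ltr_expR oppr_lt0.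
  have := He t; rewrite /= sub0r normrN gtr0_norm// => /(_ te t0).
  rewrite fE// -rmorphM -(rmorph1 (real_complex R)) -rmorphB.
  rewrite /= expr0n addr0 sqrtr_sqr normr_id [`|t ^+ 2|]ger0_norm//.
  by rewrite sqr_ge0.
move=> u v s u1 v1 s01; rewrite !mulrN -opprD lerN2.
exact: (pick_quotient_convex P Q 1 u v s Q0 cPQ PQ rQ u1 v1 s01).
Qed.
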